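(* For each $d\in\mathbb N$ let $f_d(x)=x^d+a_{d-1}x^{d-1}+a_{d-2}x^{d-2}+\dots+a_1x+a_0$ be a random polynomial of degree $d$ with integer coefficients, where the $a_i$ ($0\le i\le d-1$) are i.i.d. centered binomial random variables with parameters $4^{2d}$ and $p=\frac12$. Then $$\mathbb P(f_d(x)\text{ is irreducible over }\mathbb Z)\to1\quad\text{as } d\to\infty.$$
   Context: A centered binomial random variable with parameters $N$ ($N$ even) and $p=\frac12$ is $X-\frac N2$, where $X$ has the binomial distribution with $N$ trials and success probability $\frac12$. A polynomial with integer coefficients is irreducible over $\mathbb Z$ if it cannot be written as the product of at least two polynomials of smaller degrees with integer coefficients. *)

(* Defs.v *)
From HB Require Import structures.
From mathcomp Require Import all_boot all_order all_algebra.
From mathcomp Require Import all_classical all_reals all_analysis.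
Import Order.TTheory GRing.Theory Num.Theory.
Import numFieldNormedType.Exports.

Set Implicit Arguments.
Unset Strict Implicit.
Unset Printing Implicit Defensive.

Local Open Scope classical_set_scope.
Local Open Scope ring_scope.

HB.instance Definition _ := isPointed.Build int 0.

(* Every subset of [int] is measurable, as in the library's instance for
   [nat]; hence every event about finitely many [int]-valued random variables is
   measurable. *)
HB.instance Definition _ := @isMeasurable.Build default_measure_display
  int discrete_measurable discrete_measurable0
  discrete_measurableC discrete_measurableU.

Definition mutually_independent (R : realType) (disp disp' : measure_display)
    (T : measurableType disp) (P : probability T R)
    (T' : measurableType disp') (I : finType) (X : I -> {RV P >-> T'}) : Prop :=
  forall (J : {set I}) (B : I -> set T'),
    (forall i, i \in J -> measurable (B i)) ->
    P (\bigcap_(i in [set` J]) (X i @^-1` B i)) =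
    (\prod_(i in J) P (X i @^-1` B i))%E.

(* Meant for even [N], for which [N./2] is exactly N/2. *)
Definition centered_binomial (R : realType) (disp : measure_display)
    (T : measurableType disp) (P : probability T R) (N : nat)
    (a : {RV P >-> int}) : Prop :=
  exists X : {RV P >-> nat},
    (forall A : set nat, distribution P X A = binomial_prob N (2^-1 : R) A) /\
    (forall w : T, a w = (X w)%:Z - (N./2)%:Z).

(* [size g < size f] says that g has smaller degree than f (or is 0). *)
Definition irreducible_over_Z (f : {poly int}) : Prop :=
  ~ exists s : seq {poly int},
      [/\ (2 <= size s)%N,
          forall g, g \in s -> (size g < size f)%N
        & f = \prod_(g <- s) g].

Definition monic_of_coefs (d : nat) (c : 'I_d -> int) : {poly int} :=
  'X^d + \sum_(i < d) c i *: 'X^i.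

(* Main.v *)
Require Import Defs.
From HB Require Import structures.
From mathcomp Require Import all_boot all_order all_algebra.
From mathcomp Require Import zify ring lra.
From mathcomp Require Import all_classical all_reals all_analysis.
Import Order.TTheory GRing.Theory Num.Theory.
Import numFieldNormedType.Exports.

Set Implicit Arguments.
Unset Strict Implicit.
Unset Printing Implicit Defensive.

(** A factorization of the random polynomial over the integers produces, for
    some degree k with 0 < k <= d/2, a divisor of degree k modulo every prime
    at once.  The proof exhibits about log d primes modulo which this is
    unlikely and nearly independent.

    - Over a finite field with at least 2d elements, a uniformly random monic
      polynomial of degree d has no divisor of degree k with probability at
      least 1/8, uniformly in k ([count_no_divisor_ge]).  The reason: if
      f = s * r with deg s < k and all irreducible factors of r of degree > k,
      then a divisor of degree k is coprime to r, hence divides s, which is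
      impossible.  There are q^j choices of s of degree j < k, each pair (s, r)
      gives a different f, and a proportion at least 1/(4(k+1)) of the monic
      polynomials of a given degree > k has all irreducible factors of degree
      > k ([rough_count_ge]).  The latter is an induction on the degree, driven
      by the identity deg f = sum of deg P over the prime powers P^j dividing f
      ([sum_deg_prime_powers]), the polynomial analogue of
      log n = sum of Lambda(m) over the divisors m of n; the same identity gives
      the count of irreducible polynomials it needs.

    - Chebyshev's argument with the central binomial coefficient produces
      m = 16 log_2 d primes between 2d and 2d^2 ([many_primes]).  Their product
      Q is at most 4^d / 2d ([modulus_small]).

    - A binomial variable with N = 16^d trials falls into a residue class
      modulo Q with probability at most 1/Q + 4^-d: its distribution is
      unimodal and its largest mass is at most N^(-1/2) = 4^-d
      ([binomial_residue_prob]).  As Q is so small, the law of the d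
      coefficients modulo Q is at most twice the uniform law, and by the Chinese
      remainder theorem the uniform law modulo Q makes the reductions modulo
      the m primes independent and uniform ([splits_mod_all_count]).

    Hence for each k there are divisors of degree k modulo all m primes with
    probability at most 2 (7/8)^m, and the sum over the at most d possible
    values of k is O(1/d). *)

(** * Monic polynomials over a finite field and their irreducible factors *)

Local Open Scope ring_scope.

Definition monic_poly (R : nzRingType) (d : nat) (c : 'I_d -> R) : {poly R} :=
  'X^d + \sum_(i < d) c i *: 'X^i.

Lemma monic_polyE (R : nzRingType) d (c : 'I_d -> R) :
  monic_poly c = 'X^d + \poly_(i < d) (if insub i is Some j then c j else 0).
Proof.
rewrite /monic_poly poly_def; congr (_ + _); apply: eq_bigr => i _.
by rewrite valK.
Qed.

Lemma size_monic_poly (R : nzRingType) d (c : 'I_d -> R) :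
  size (monic_poly c) = d.+1.
Proof. by rewrite monic_polyE size_polyDl size_polyXn // ltnS size_poly. Qed.

Lemma monic_monic_poly (R : nzRingType) d (c : 'I_d -> R) :
  monic_poly c \is monic.
Proof.
by rewrite monicE monic_polyE lead_coefDl ?lead_coefXn // size_polyXn ltnS size_poly.
Qed.

Lemma coef_monic_poly (R : nzRingType) d (c : 'I_d -> R) (i : 'I_d) :
  (monic_poly c)`_i = c i.
Proof.
by rewrite monic_polyE coefD coefXn coef_poly ltn_ord valK ltn_eqF ?add0r.
Qed.

Lemma monic_poly_coef (R : nzRingType) d (f : {poly R}) :
  f \is monic -> size f = d.+1 -> monic_poly (fun i : 'I_d => f`_i) = f.
Proof.
move=> /monicP fm sf; apply/polyP => i.
rewrite monic_polyE coefD coefXn coef_poly.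
have [lt_id|] := ltnP i d; first by rewrite insubT /= ltn_eqF ?add0r.
rewrite leq_eqVlt => /predU1P[<-|lt_di].
  by rewrite eqxx addr0 -fm lead_coefE sf.
by rewrite gtn_eqF // addr0 nth_default // sf.
Qed.

Lemma eq_monic_poly (R : nzRingType) d (c c' : 'I_d -> R) :
  c =1 c' -> monic_poly c = monic_poly c'.
Proof. by move=> cc'; congr (_ + _); apply: eq_bigr => i _; rewrite cc'. Qed.

Section FiniteField.
Variable F : finFieldType.
Implicit Types (f g P : {poly F}) (n k d e : nat).
Let q := #|F|.

Lemma dvdp_cofactor P f : P %| f -> exists g : {poly F}, f = g * P.
Proof. by case/dvdpP=> g; exists g. Qed.

Definition monics n : seq {poly F} :=
  [seq monic_poly c | c : {ffun 'I_n -> F}].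

Lemma mem_monics n f : (f \in monics n) = (f \is monic) && (size f == n.+1).
Proof.
apply/fintype.imageP/andP => [[c _ ->]|[fm /eqP sf]].
  by rewrite monic_monic_poly size_monic_poly eqxx.
exists [ffun i : 'I_n => f`_i] => //; rewrite -[LHS](monic_poly_coef fm sf).
by apply: eq_monic_poly => i; rewrite ffunE.
Qed.

Lemma uniq_monics n : uniq (monics n).
Proof.
apply/injectiveP => c c' cc'; apply/ffunP => i.
by rewrite -!(coef_monic_poly, cc').
Qed.

Lemma size_monics n : size (monics n) = (q ^ n)%N.
Proof. by rewrite size_image card_ffun card_ord. Qed.

Lemma count_monics_mul (A : pred {poly F}) P e n : P \in monics e ->
  count (fun f => (P %| f) && A (f %/ P)) (monics n) =
  if (e <= n)%N then count A (monics (n - e)) else 0%N.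
Proof.
rewrite mem_monics => /andP[Pm /eqP sP].
have P0 := monic_neq0 Pm.
case: ifP => [le_en|/negbT]; last first.
  rewrite -ltnNge => lt_ne; apply/eqP; rewrite eqn0Ngt -has_count.
  apply/hasPn => f; rewrite mem_monics => /andP[fm /eqP sf]; apply/negP.
  by case/andP=> /(dvdp_leq (monic_neq0 fm)); rewrite sP sf ltnS leqNgt lt_ne.
have perm : perm_eq [seq f <- monics n | P %| f]
                    [seq g * P | g <- monics (n - e)].
  apply: uniq_perm; first by rewrite filter_uniq ?uniq_monics.
    by rewrite (map_inj_uniq (mulIf P0)) uniq_monics.
  move=> f; rewrite mem_filter mem_monics; apply/andP/mapP.
    case=> /dvdp_cofactor[g ->] /andP[fm /eqP sf].
    have gm : g \is monic by rewrite -(monicMr _ Pm).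
    exists g => //; rewrite mem_monics gm /=; move: sf.
    rewrite size_Mmonic ?monic_neq0 // sP addnS /= => sf.
    by apply/eqP; rewrite -subSn // -sf addnK.
  case=> g; rewrite mem_monics => /andP[gm /eqP sg] ->.
  split; first exact: dvdp_mulIr.
  by rewrite monicMr // gm size_monicM ?monic_neq0 // sP sg addnS /= addSn subnK.
transitivity (count (fun f => A (f %/ P)) [seq f <- monics n | P %| f]).
  by rewrite count_filter; apply: eq_count => f /=; rewrite andbC.
rewrite (permP perm) count_map; apply: eq_count => g /=.
by rewrite mulpK.
Qed.

Definition irreds e : seq {poly F} := [seq P <- monics e | irreducibleb P].

Lemma mem_irreds e P :
  P \in irreds e = [&& irreducibleb P, P \is monic & size P == e.+1].
Proof. by rewrite mem_filter mem_monics. Qed.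

Lemma uniq_irreds e : uniq (irreds e).
Proof. by rewrite filter_uniq ?uniq_monics. Qed.

Lemma irreducible_factor f : (1 < size f)%N ->
  exists2 P, irreducible_poly P & (P \is monic) && (P %| f).
Proof.
have [n] := ubnP (size f); elim: n f => // n IHn f /ltnSE le_fn sf.
have f0 : f != 0 by rewrite -size_poly_gt0 ltnW.
have [irr|] := boolP (irreducibleb f).
  exists ((lead_coef f)^-1 *: f).
    have l0 : (lead_coef f)^-1 != 0 by rewrite invr_eq0 lead_coef_eq0.
    case/irreducibleP: irr => sf1 irr; split; first by rewrite size_scale.
    move=> g sg gf; rewrite (eqp_rtrans (eqp_scale f l0)).
    by apply: irr => //; rewrite -(dvdpZr _ _ l0).
  rewrite monicE lead_coefZ mulVf ?lead_coef_eq0 // eqxx /=.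
  by rewrite dvdpZl ?dvdpp // invr_eq0 lead_coef_eq0.
rewrite /irreducibleb sf /= negb_forall => /existsP[/= g].
rewrite negb_imply -Pdiv.Idomain.dvdpE -ltnNge => /andP[gf sg].
have lt_gf : (size g < size f)%N by rewrite (leq_ltn_trans (size_npoly g)) // ltn_predL ltnW.
have [|P irrP /andP[Pm Pg]] := IHn g _ sg; first exact: leq_trans le_fn.
by exists P => //; rewrite Pm (dvdp_trans Pg).
Qed.

Lemma irreducible_dvd_mul P f g : irreducible_poly P ->
  (P %| f * g) = (P %| f) || (P %| g).
Proof.
move=> irrP; have [Pf|nPf] := boolP (P %| f); first by rewrite dvdp_mulr.
by rewrite Gauss_dvdpr // irreducible_poly_coprime.
Qed.

Lemma irreducible_dvd_monic P Q : irreducible_poly P -> irreducible_poly Q ->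
  P \is monic -> Q \is monic -> P %| Q -> P = Q.
Proof.
move=> [sP _] [_ irrQ] Pm Qm PQ; apply/eqP; rewrite -eqp_monic //.
by apply: irrQ => //; rewrite gtn_eqF.
Qed.

(** Logarithmic form of unique factorization: an irreducible P contributes its
    degree once for every power of P dividing f, that is, as often as its
    multiplicity.  Splitting one irreducible factor P0 off f lowers the
    multiplicity of P0 by one and leaves the others unchanged.  The bound D only
    makes the sums finite. *)
Lemma sum_deg_prime_powers D n f : f \in monics n -> (n <= D)%N ->
  (\sum_(1 <= e < D.+1) \sum_(P <- irreds e) \sum_(1 <= j < D.+1)
     (P ^+ j %| f)%R * e = n)%N.
Proof.
elim/ltn_ind: n f => -[|n] IHn f; rewrite mem_monics => /andP[fm /eqP sf] le_nD.
  rewrite big_nat big1 // => e _; rewrite big_seq big1 // => P.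
  rewrite mem_irreds => /and3P[/irreducibleP[sP _] _ _].
  rewrite big_nat big1 // => -[//|j] _; case: (boolP (_ %| f)) => //.
  move=> /(dvdp_trans (dvdp_exp2l _ (ltn0Sn j))) /(dvdp_leq (monic_neq0 fm)).
  by rewrite expr1 sf leqNgt sP.
have [P0 irrP0 /andP[P0m]] : exists2 P, irreducible_poly P & (P \is monic) && (P %| f).
  by apply: irreducible_factor; rewrite sf.
case/dvdp_cofactor=> g def_f.
set d0 := (size P0).-1; have sP0 : size P0 = d0.+1.
  by rewrite prednK //; case: irrP0 => /ltnW.
have d0_gt0 : (0 < d0)%N by case: irrP0; rewrite sP0.
have gm : g \is monic by rewrite -(monicMr _ P0m) -def_f.
have [m dm sg] : exists2 m, (m + d0 = n.+1)%N & size g = m.+1.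
  exists (size g).-1; last by rewrite prednK // size_poly_gt0 monic_neq0.
  move: sf; rewrite def_f size_Mmonic ?monic_neq0 // sP0 addnS /= => sgd.
  by apply: succn_inj; rewrite -sgd -addSn prednK // size_poly_gt0 monic_neq0.
have gM : g \in monics m by rewrite mem_monics gm sg eqxx.
have IHg := IHn m _ g gM _; rewrite -dm.
have in1 : P0 \in irreds d0.
  by rewrite mem_irreds P0m sP0 eqxx !andbT; apply/irreducibleP.
transitivity (\sum_(1 <= e < D.+1) \sum_(P <- irreds e)
   ((\sum_(1 <= j < D.+1) (P ^+ j %| g)%R * e) + (P == P0) * e))%N; last first.
  rewrite (eq_bigr (fun e => \sum_(P <- irreds e) \sum_(1 <= j < D.+1) (P ^+ j %| g)%R * e
    + (e == d0) * d0)%N).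
    rewrite big_split /= IHg; try lia; congr (_ + _)%N.
    rewrite (bigD1_seq d0) ?iota_uniq //=; last by rewrite mem_index_iota; lia.
    by rewrite eqxx mul1n big1 ?addn0 // => e /negPf->.
  move=> e _; rewrite big_split /=; congr (_ + _)%N.
  have [->|ne] := eqVneq e d0.
    rewrite (bigD1_seq P0) ?uniq_irreds //= eqxx big1 ?addn0 // => P /negPf->.
    by [].
  rewrite big_seq big1 // => P; rewrite mem_irreds => /and3P[_ _ /eqP sP].
  by case: eqP => // eqP0; move: ne; rewrite -[e]/(e.+1.-1) -sP eqP0 eqxx.
apply: eq_big_nat => e _; rewrite big_seq [RHS]big_seq.
apply: eq_bigr => P; rewrite mem_irreds => /and3P[/irreducibleP irrP Pm /eqP sP].
case: (eqVneq P P0) => [eqP0|neP0]; last first.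
  rewrite addn0; apply: eq_bigr => j _; rewrite def_f Gauss_dvdpl //.
  rewrite coprimep_expl // irreducible_poly_coprime //; apply: contra neP0 => PP0.
  exact/eqP/irreducible_dvd_monic.
rewrite eqP0 in irrP Pm sP *; rewrite mul1n.
(* P0 ^+ j divides f = g * P0 exactly when P0 ^+ j.-1 divides g; the term of
   index D vanishes for g by degree. *)
have -> : (\sum_(1 <= j < D.+1) (P0 ^+ j %| f)%R * e = \sum_(0 <= j < D) (P0 ^+ j %| g)%R * e)%N.
  rewrite big_add1 /=; apply: eq_bigr => j _.
  by rewrite def_f exprSr dvdp_mul2r ?monic_neq0.
have -> : (\sum_(1 <= j < D.+1) (P0 ^+ j %| g)%R * e = \sum_(1 <= j < D) (P0 ^+ j %| g)%R * e)%N.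
  rewrite big_nat_recr /=; last by lia.
  case: (boolP (P0 ^+ D %| g)); last by rewrite addn0.
  move=> /(dvdp_leq (monic_neq0 gm)) le_szD.
  have : ((size (P0 ^+ D)).-1 <= m)%N.
    by rewrite -ltnS -sg (leq_trans _ le_szD) // prednK // size_poly_gt0 expf_neq0 ?monic_neq0.
  by rewrite size_exp sP0 /=; nia.
rewrite big_ltn; last by lia.
by rewrite expr0 dvd1p mul1n addnC.
Qed.

(** The analogue for polynomials of the integers free of small prime factors:
    all irreducible factors of f have degree greater than k. *)
Definition rough k f : bool :=
  all (fun e => ~~ has (fun P => P %| f) (irreds e)) (iota 1 k).

Lemma roughP k f :
  reflect (forall P, irreducible_poly P -> P \is monic -> P %| f -> (k.+1 < size P)%N)
          (rough k f).
Proof.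
apply: (iffP allP) => [rf P irrP Pm Pf|rf e].
  have sP : size P = (size P).-1.+1 by rewrite prednK // size_poly_gt0 monic_neq0.
  have sP1 : (1 < size P)%N by case: irrP.
  rewrite ltnNge; apply/negP => le_sk.
  have PI : P \in irreds (size P).-1.
    by rewrite mem_irreds Pm -sP eqxx !andbT; apply/irreducibleP.
  have /rf/hasPn/(_ P PI) : (size P).-1 \in iota 1 k.
    by rewrite mem_iota; move: sP sP1 le_sk; set s := size _; clear; lia.
  by rewrite Pf.
rewrite mem_iota => /andP[_ le_ek]; apply/hasPn => P.
rewrite mem_irreds => /and3P[/irreducibleP irrP Pm /eqP sP]; apply/negP => Pf.
by have := rf P irrP Pm Pf; rewrite sP; lia.
Qed.

Lemma roughM k f g : rough k (f * g) = rough k f && rough k g.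
Proof.
apply/roughP/andP => [rfg|[/roughP rf /roughP rg] P irrP Pm].
  by split; apply/roughP => P irrP Pm Pf; apply: rfg;
     rewrite // (irreducible_dvd_mul _ _ irrP) Pf ?orbT.
by rewrite (irreducible_dvd_mul _ _ irrP) => /orP[]; [apply: rf|apply: rg].
Qed.

Lemma rough_irreducible k e P : P \in irreds e -> rough k P = (k < e)%N.
Proof.
rewrite mem_irreds => /and3P[/irreducibleP irrP Pm /eqP sP].
apply/roughP/idP => [/(_ P irrP Pm (dvdpp _))|ltke Q irrQ Qm QP].
  by rewrite sP.
by rewrite (irreducible_dvd_monic irrQ irrP Qm Pm QP) sP.
Qed.

Lemma rough1 k : rough k 1.
Proof.
by apply/roughP=> P [sP _] Pm /(dvdp_leq (oner_neq0 _)); rewrite size_poly1 leqNgt sP.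
Qed.

Lemma rough_exp k f j : rough k f -> rough k (f ^+ j).
Proof. by move=> rf; elim: j => [|j IH]; rewrite ?rough1 // exprS roughM rf. Qed.

Definition rough_count k n := count (rough k) (monics n).

Lemma monics0 : monics 0 = [:: 1].
Proof.
have s1 : size (monics 0) = 1%N by rewrite size_monics expn0.
have : (1 : {poly F}) \in monics 0 by rewrite mem_monics rpred1 size_poly1 eqxx.
by case: (monics 0) s1 => [|f [|]] //= _; rewrite inE => /eqP->.
Qed.

Lemma rough_count0 k : rough_count k 0 = 1%N.
Proof. by rewrite /rough_count monics0 /= rough1. Qed.

Lemma rough_count_all n : rough_count 0 n = (q ^ n)%N.
Proof. by rewrite /rough_count -size_monics; apply/eqP; rewrite -all_count; apply/allP. Qed.

Lemma exp_monics e P j : P \in monics e -> P ^+ j \in monics (e * j).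
Proof.
rewrite !mem_monics => /andP[Pm /eqP sP]; rewrite rpredX //=.
have : (size (P ^+ j)).-1 = (e * j)%N by rewrite size_exp sP.
by move <-; rewrite prednK // size_poly_gt0 expf_neq0 ?monic_neq0.
Qed.

(** Sum the identity [sum_deg_prime_powers] over the rough polynomials f of
    degree n: those divisible by P ^+ j, with P rough, are the products of P ^+ j
    with a rough polynomial of degree n - j * deg P. *)
Lemma rough_count_rec D k n : (n <= D)%N ->
  (n * rough_count k n = \sum_(k.+1 <= e < D.+1) size (irreds e) * e *
     \sum_(1 <= j < D.+1) (if e * j <= n then rough_count k (n - e * j) else 0))%N.
Proof.
move=> le_nD; rewrite /rough_count -sum1_count mulnC big_distrl /=.
transitivity (\sum_(1 <= e < D.+1) \sum_(P <- irreds e) \sum_(1 <= j < D.+1)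
   count (fun f => (P ^+ j %| f)%R && rough k f) (monics n) * e)%N.
  rewrite big_seq_cond (eq_bigr (fun f => \sum_(1 <= e < D.+1)
     \sum_(P <- irreds e) \sum_(1 <= j < D.+1) (P ^+ j %| f)%R * e)%N); last first.
    by move=> f /andP[fM _]; rewrite mul1n (sum_deg_prime_powers fM).
  rewrite -big_seq_cond exchange_big /=; apply: eq_bigr => e _.
  rewrite exchange_big /=; apply: eq_bigr => P _.
  rewrite exchange_big /=; apply: eq_bigr => j _.
  rewrite -big_distrl /=; congr (_ * _)%N.
  rewrite -sum1_count big_mkcond [RHS]big_mkcond; apply: eq_bigr => f _ /=.
  by case: (rough k f); rewrite ?andbF // andbT; case: ifP.
have zero e P j : P \in irreds e -> (e <= k)%N -> (0 < j)%N ->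
    count (fun f => (P ^+ j %| f)%R && rough k f) (monics n) = 0%N.
  move=> PI le_ek j0; apply/eqP; rewrite eqn0Ngt -has_count; apply/hasPn => f _.
  apply/negP => /andP[/dvdp_cofactor[g ->]]; rewrite roughM.
  by case: j j0 => // j _; rewrite exprS roughM (rough_irreducible k PI) ltnNge le_ek andbF.
have eqP e P j : P \in irreds e -> (k < e)%N ->
    count (fun f => (P ^+ j %| f)%R && rough k f) (monics n) =
    if (e * j <= n)%N then count (rough k) (monics (n - e * j)) else 0%N.
  move=> PI lt_ke; have PM : P ^+ j \in monics (e * j).
    by apply: exp_monics; move: PI; rewrite mem_filter => /andP[].
  rewrite -(count_monics_mul (rough k) n PM); apply: eq_count => f /=.
  case: (boolP (_ %| _)) => //= Pf; rewrite -[f in LHS](divpK Pf) roughM.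
  by rewrite (rough_exp j (_ : rough k P)) ?andbT // (rough_irreducible k PI).
have term e : (\sum_(P <- irreds e) \sum_(1 <= j < D.+1)
    count (fun f => (P ^+ j %| f)%R && rough k f) (monics n) * e =
    if k < e then size (irreds e) * e * \sum_(1 <= j < D.+1)
        (if e * j <= n then count (rough k) (monics (n - e * j)) else 0) else 0)%N.
  case: ltnP => le_ke.
    rewrite big_seq (eq_bigr (fun=> e * \sum_(1 <= j < D.+1)
        (if e * j <= n then count (rough k) (monics (n - e * j)) else 0))%N).
      by rewrite -big_seq big_const_seq count_predT iter_addn_0 mulnC mulnA.
    move=> P PI; rewrite big_distrr /=; apply: eq_bigr => j _.
    by rewrite (eqP e P j PI) // mulnC.
  rewrite big_seq big1 // => P PI; rewrite big_nat big1 // => j /andP[j0 _].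
  by rewrite (zero e).
rewrite (eq_bigr _ (fun e _ => term e)).
have [le_kD|lt_Dk] := leqP k D; last first.
  rewrite [RHS]big_geq; last by lia.
  by rewrite big_nat big1 // => e /andP[_ ?]; rewrite ltnNge ifF //; apply/negbTE; lia.
rewrite (big_cat_nat (n := k.+1)) //= big_nat big1 ?add0n.
  by apply: eq_big_nat => e /andP[-> _].
by move=> e /andP[_ ?]; rewrite ifF //; apply/negbTE; lia.
Qed.

(** Gauss's formula for the number of irreducible polynomials.  All monic
    polynomials are 0-rough, so [rough_count_rec] in degrees n and n + 1 gives
    two identities between known quantities; q times the first, subtracted from
    the second, leaves the terms with j * deg P = n + 1. *)
Lemma sum_irreds_divisors n :
  (\sum_(1 <= e < n.+2) size (irreds e) * e * \sum_(1 <= j < n.+2) (e * j == n.+1)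
   = q ^ n.+1)%N.
Proof.
have := rough_count_rec 0 (leqnn n.+1); have := rough_count_rec 0 (leqnSn n).
rewrite !rough_count_all.
set S0 := bigop.body _ _ _; set S1 := bigop.body _ _ _ => E0 E1.
set S := bigop.body _ _ _.
suff : (S1 = q * S0 + S)%N by rewrite -E0 -E1 expnS; nia.
rewrite /S0 /S1 /S big_distrr -big_split /=; apply: eq_bigr => e _.
rewrite mulnCA -mulnDr; congr (_ * _)%N.
rewrite big_distrr -big_split /=; apply: eq_bigr => j _.
rewrite !rough_count_all; case: (ltngtP (e * j) n.+1) => [lt|gt|->].
- by rewrite -ltnS lt addn0 subSn // expnS.
- by rewrite leqNgt (ltnW gt) muln0.
by rewrite ltnn muln0 subnn.
Qed.

Lemma finField_ge2 : (1 < q)%N.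
Proof. exact: card_finNzRing_gt1. Qed.

Lemma sum_mul_eq_le1 e n D : (0 < e)%N -> (\sum_(1 <= j < D) (e * j == n) <= 1)%N.
Proof.
move=> e0; apply: (@leq_trans (\sum_(1 <= j < D) (n %/ e == j))).
  by apply: leq_sum => j _; case: (e * j =P n) => // <-; rewrite mulKn // eqxx.
rewrite -big_mkcond /= sum1_count -(eq_count (a1 := pred1 (n %/ e)%N)); last by move=> j /=; rewrite eq_sym.
by rewrite count_uniq_mem ?iota_uniq // leq_b1.
Qed.

Lemma card_irreds_le n : (n * size (irreds n) <= q ^ n)%N.
Proof.
case: n => // n; rewrite -sum_irreds_divisors big_nat_recr //= (leq_trans _ (leq_addl _ _)) //.
by rewrite mulnC big_ltn // muln1 eqxx mulnDr muln1 leq_addr.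
Qed.

Lemma card_irreds_ge n : (q ^ n.+1 <= n.+1 * size (irreds n.+1) + 2 * q ^ n)%N.
Proof.
have q2 := finField_ge2.
rewrite -sum_irreds_divisors big_nat_recr //= addnC leq_add //.
  by rewrite mulnC [(n.+1 * _)%N]mulnC -[X in (_ <= X)%N]mul1n leq_mul // sum_mul_eq_le1.
apply: (@leq_trans (\sum_(1 <= e < n.+1) q ^ e)).
  rewrite big_nat [X in (_ <= X)%N]big_nat; apply: leq_sum => e /andP[e0 _].
  rewrite -[X in (_ <= X)%N]muln1 leq_mul ?sum_mul_eq_le1 //.
  by rewrite mulnC card_irreds_le.
elim: n => [|n IHn]; first by rewrite big_geq.
by rewrite big_nat_recr //= expnS; move: IHn; set s := bigop.body _ _ _; nia.
Qed.


(** * Polynomials without a divisor of given degree *)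

(** The terms j = 1 of [rough_count_rec], with the number of irreducible
    polynomials of degree e replaced by its lower bound
    (q ^ e - 2 * q ^ e.-1) / e. *)
Lemma rough_count_ge_sum k n :
  ((q - 2) * \sum_(k.+1 <= e < n.+1) q ^ e * rough_count k (n - e) <=
   q * n * rough_count k n)%N.
Proof.
rewrite -mulnA (rough_count_rec k (leqnn n)) !big_distrr /= big_nat [X in (_ <= X)%N]big_nat.
apply: leq_sum => -[//|e] /andP[_ lt_en].
rewrite big_ltn; last by lia.
rewrite muln1 (_ : (e.+1 <= n)%N); last by rewrite -ltnS.
have := card_irreds_ge e; rewrite expnS.
set I := size _; set r := rough_count _ _; set s := bigop.body _ _ _; set Q := (q ^ e)%N => H.
have : ((q - 2) * Q <= I * e.+1)%N by rewrite mulnBl; lia.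
have q1 := finField_ge2.
move=> /(leq_mul (leqnn (q * r))); nia.
Qed.

(** Induction on n in the recursion [rough_count_ge_sum]: the term of index n
    gives q ^ n, the terms with k < n - e are bounded below by the induction
    hypothesis.  The factor 1 - 2/q lost at each step is harmless because
    q >= 2n. *)
Lemma rough_count_ge k n : (k < n)%N -> (4 <= q)%N -> (2 * n <= q)%N ->
  (q ^ n <= 4 * k.+1 * rough_count k n)%N.
Proof.
move=> + q4; elim/ltn_ind: n => n IHn lt_kn le_nq.
have := rough_count_ge_sum k n.
suff le_sum : (q * n * q ^ n <=
     4 * k.+1 * ((q - 2) * \sum_(k.+1 <= e < n.+1) q ^ e * rough_count k (n - e)))%N.
  have qn0 : (0 < q * n)%N by lia.
  move=> /(leq_mul (leqnn (4 * k.+1)))/(leq_trans le_sum).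
  by rewrite mulnCA leq_pmul2l.
rewrite big_nat_recr //= subnn rough_count0 muln1.
set S := bigop.body _ _ _.
have leS : ((n - (k + k.+1)) * q ^ n <= 4 * k.+1 * S)%N.
  have [le_kkn|lt_nkk] := leqP (k + k.+1) n; last by rewrite (eqP (ltnW lt_nkk : (_ - _ == 0)%N)).
  rewrite /S (big_cat_nat (n := n - k)) /=; try lia.
  rewrite mulnDr (leq_trans _ (leq_addr _ _)) //.
  have -> : (n - (k + k.+1) = \sum_(k.+1 <= e < n - k) 1)%N.
    by rewrite sum_nat_const_nat muln1 subnDA.
  rewrite big_distrl big_distrr /= big_nat [X in (_ <= X)%N]big_nat.
  apply: leq_sum => e /andP[lt_ke lt_e].
  rewrite mul1n -[X in (q ^ X)%N](@subnKC e n) ?expnD; last by lia.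
  rewrite mulnCA leq_mul // IHn //; lia.
have q0 : (0 < q ^ n)%N by rewrite expn_gt0; lia.
move: leS; set Q := (q ^ n)%N; set T := (4 * k.+1 * S)%N => leS.
rewrite mulnCA mulnDr -/T.
apply: (@leq_trans ((q - 2) * ((n - (k + k.+1)) * Q + 4 * k.+1 * Q))); last first.
  by rewrite leq_mul // leq_add2r.
rewrite -mulnDl mulnA leq_mul //.
have [le_kkn|lt_nkk] := leqP (k + k.+1) n; last first.
  rewrite (_ : (n - _ = 0)%N); last by lia.
  by rewrite add0n; move: lt_nkk q4; clear; nia.
have [p Ep] : exists p, q = p.+2 by exists (q - 2)%N; lia.
have [m Em] : exists m, n = (m + (k + k.+1))%N by exists (n - (k + k.+1))%N; lia.
move: q4 le_nq; rewrite Em addnK Ep subn2 /= => p2 le_p; clear -p2 le_p.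
have : (p * 3 <= p * (2 * k + 3))%N by rewrite leq_mul // leq_addl.
move=> H; nia.
Qed.

Definition no_divisor k f : bool := ~~ has (fun g => g %| f) (monics k).

Lemma no_divisorP k f :
  reflect (forall g, size g = k.+1 -> ~~ (g %| f)) (no_divisor k f).
Proof.
apply: (iffP hasPn) => [nd g sg|nd g]; last by rewrite mem_monics => /andP[_ /eqP/nd].
have g0 : g != 0 by rewrite -size_poly_gt0 sg.
have l0 : (lead_coef g)^-1 != 0 by rewrite invr_eq0 lead_coef_eq0.
rewrite -(dvdpZl _ _ l0); apply: nd.
by rewrite mem_monics monicE lead_coefZ mulVf ?lead_coef_eq0 // eqxx size_scale // sg eqxx.
Qed.

Lemma coprime_rough k f g : rough k f -> g != 0 -> (size g <= k.+1)%N -> coprimep f g.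
Proof.
move=> /roughP rf g0 le_gk; rewrite /coprimep; apply: contraT => s1.
have d0 : gcdp f g != 0 by rewrite gcdp_eq0 negb_and g0 orbT.
have [P irrP /andP[Pm Pd]] : exists2 P, irreducible_poly P & (P \is monic) && (P %| gcdp f g).
  apply: irreducible_factor; move: s1 d0; rewrite -size_poly_eq0.
  by case: (size _) => [|[]].
have := rf P irrP Pm (dvdp_trans Pd (dvdp_gcdl _ _)).
by rewrite ltnNge (leq_trans (dvdp_leq g0 (dvdp_trans Pd (dvdp_gcdr _ _)))).
Qed.

(** A divisor of degree k is coprime to r, hence divides s, whose degree is
    too small. *)
Lemma no_divisor_rough_mul k (s r : {poly F}) : (size s <= k)%N -> s != 0 -> rough k r -> no_divisor k (s * r).
Proof.
move=> ss s0 rr; apply/no_divisorP => g sg; apply/negP.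
have g0 : g != 0 by rewrite -size_poly_gt0 sg.
rewrite Gauss_dvdpl; last by rewrite coprimep_sym (coprime_rough rr) ?sg.
by move/(dvdp_leq s0); rewrite sg leqNgt ltnS ss.
Qed.

(** The rough part and the complementary part of a product determine each other:
    s is coprime to r' and s' is coprime to r, so s and s' divide each other. *)
Lemma rough_decomposition_inj k (s s' r r' : {poly F}) :
  s \is monic -> s' \is monic -> (size s <= k)%N -> (size s' <= k)%N -> rough k r -> rough k r' ->
  s * r = s' * r' -> s = s' /\ r = r'.
Proof.
move=> sm sm' ss ss' rr rr' E.
have dvd t t' w w' : t \is monic -> t' \is monic -> (size t <= k)%N -> rough k w' ->
    t * w = t' * w' -> t %| t'.
  move=> tm tm' st rw' E'.
  rewrite -(@Gauss_dvdpl _ t' w'); last first.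
    by rewrite coprimep_sym (coprime_rough rw') ?monic_neq0 // (leq_trans st).
  by rewrite -E' dvdp_mulr.
have Es : s = s'.
  apply/eqP; rewrite -eqp_monic // /eqp.
  by rewrite (dvd _ _ _ _ sm sm' ss rr' E) (dvd _ _ _ _ sm' sm ss' rr (esym E)).
split=> //; apply: (mulfI (monic_neq0 sm)); by rewrite E Es.
Qed.

(** By [no_divisor_rough_mul] and [rough_decomposition_inj], the products s * r
    with s of degree j < k and r rough of degree d - j are distinct polynomials
    without a divisor of degree k. *)
Lemma count_no_divisor_ge_sum k d : (k <= d)%N ->
  (\sum_(0 <= j < k) q ^ j * rough_count k (d - j) <= count (no_divisor k) (monics d))%N.
Proof.
move=> le_kd.
pose S := [seq s | j <- iota 0 k, s <- monics j].
pose T := [seq s * r | s : {poly F} <- S, r <- [seq r <- monics (d - (size s).-1) | rough k r]].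
have memS (s : {poly F}) : s \in S -> s \is monic /\ (size s <= k)%N.
  case/allpairsPdep => j [t [jk tM ->]]; move: jk tM.
  by rewrite mem_iota mem_monics => /andP[_ ?] /andP[-> /eqP->].
have uS : uniq S.
  apply: allpairs_uniq_dep; [exact: iota_uniq|by move=> j _; exact: uniq_monics|].
  have tagE (p : {j : nat & {poly F}}) :
      p \in [seq @Tagged nat j (fun=> {poly F}) s | j <- iota 0 k, s <- monics j] ->
      tag p = (size (tagged p)).-1.
    by case/allpairsPdep => j [s [_ + ->]] /=; rewrite mem_monics => /andP[_ /eqP ->].
  move=> [j s] [j' s'] /tagE /= -> /tagE /= -> /= E.
  by rewrite E.
have uT : uniq T.
  apply: allpairs_uniq_dep => // [s _|]; first by rewrite filter_uniq ?uniq_monics.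
  have memT (p : {s : {poly F} & {poly F}}) :
      p \in [seq @Tagged {poly F} s (fun=> {poly F}) r | s <- S,
               r <- [seq r <- monics (d - (size s).-1) | rough k r]] ->
      [/\ tag p \is monic, (size (tag p) <= k)%N & rough k (tagged p)].
    case/allpairsPdep => s [r [/memS[sm ss] + ->]].
    by rewrite mem_filter => /andP[].
  move=> [s r] [s' r'] /memT[/= sm ss rr] /memT[/= sm' ss' rr'] E.
  by have [-> ->] := rough_decomposition_inj sm sm' ss ss' rr rr' E.
have szT : (size T = \sum_(0 <= j < k) q ^ j * rough_count k (d - j))%N.
  rewrite size_allpairs_dep sumnE big_map big_allpairs_dep /=.
  rewrite /index_iota subn0; apply: eq_bigr => j _.
  rewrite big_seq (eq_bigr (fun=> rough_count k (d - j))).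
    by rewrite -big_seq big_const_seq count_predT iter_addn_0 size_monics mulnC.
  by move=> s; rewrite mem_monics => /andP[_ /eqP->]; rewrite size_filter.
rewrite -szT -size_filter; apply: uniq_leq_size => // f.
case/allpairsPdep => s [r [/memS[sm ss]]].
rewrite mem_filter => /andP[rr]; rewrite mem_monics => /andP[rm /eqP sr] ->.
rewrite mem_filter no_divisor_rough_mul ?monic_neq0 //= mem_monics rpredM //=.
have s0 : (0 < size s)%N by rewrite size_poly_gt0 monic_neq0.
rewrite size_monicM ?monic_neq0 // sr; apply/eqP.
move: s0 ss le_kd; set z := size s; clear; lia.
Qed.

(** Each of the k terms of [count_no_divisor_ge_sum] is at least
    q ^ d / (4 * k.+1), and k / (4 * k.+1) >= 1/8. *)
Lemma count_no_divisor_ge k d : (0 < k)%N -> (2 * k <= d)%N -> (4 <= q)%N -> (2 * d <= q)%N ->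
  (q ^ d <= 8 * count (no_divisor k) (monics d))%N.
Proof.
move=> k0 le_kd q4 le_dq; have H : (k <= d)%N by lia.
move/count_no_divisor_ge_sum: H; set B := count _ _ => H.
have : (k * q ^ d <= 4 * k.+1 * B)%N.
  apply: leq_trans (leq_mul (leqnn _) H).
  have -> : (k * q ^ d = \sum_(0 <= j < k) q ^ d)%N by rewrite sum_nat_const_nat subn0.
  rewrite big_distrr /= big_nat [X in (_ <= X)%N]big_nat; apply: leq_sum => j /andP[_ lt_jk].
  rewrite -[X in (q ^ X)%N](@subnKC j d) ?expnD; last by lia.
  by rewrite mulnCA leq_mul // rough_count_ge //; lia.
move=> H1; rewrite -(leq_pmul2l k0) (leq_trans H1) //.
rewrite !mulnA leq_mul //; lia.
Qed.

End FiniteField.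

Local Open Scope nat_scope.

(** * Chebyshev's lower bound for the number of primes *)

Lemma central_binomialS n : n.+1 * 'C(2 * n.+1, n.+1) = 2 * (2 * n).+1 * 'C(2 * n, n).
Proof.
have := mul_bin_diag (2 * n.+1) n; have := mul_bin_down (2 * n).+1 n.
rewrite mulnS add2n /= (_ : (2 * n).+1 - n = n.+1); last by lia.
nia.
Qed.

Lemma central_binomial_ge n : 2 ^ n <= 'C(2 * n, n).
Proof.
elim: n => [|n IHn]; first by rewrite bin0.
rewrite -(@leq_pmul2l n.+1) // central_binomialS expnS; nia.
Qed.

(** The largest mass of the symmetric binomial law with N = 2n trials is at most
    (N + 1) ^ (-1/2), squared and cleared of denominators to allow an induction
    on n. *)
Lemma central_binomial_sqr n : 'C(2 * n, n) ^ 2 * (2 * n).+1 <= 16 ^ n.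
Proof.
elim: n => [|n IHn]; first by rewrite bin0.
rewrite -(@leq_pmul2l (n.+1 ^ 2)) ?expn_gt0 // mulnA -expnMn central_binomialS.
rewrite [16 ^ _]expnS -!mulnn.
have : (2 * n).+1 * (2 * n.+1).+1 <= 4 * (n.+1 * n.+1) by nia.
move: IHn; rewrite -mulnn; set B := 'C(_, _) * 'C(_, _); set E := 16 ^ n => IHn H.
have := leq_mul IHn H; rewrite /B; move: 'C(_, _) E {IHn H B} => c E; lia.
Qed.

Lemma divn_double_le n m : 0 < m -> (2 * n) %/ m <= (2 * (n %/ m)).+1.
Proof.
move=> m0; rewrite -ltnS ltn_divLR //.
by have := ltn_ceil n m0; nia.
Qed.

(** In Legendre's formula for the factorials, the power p ^ k contributes
    (2n) %/ p ^ k - 2 (n %/ p ^ k) to the exponent; this is 0 or 1, and it is 0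
    when p ^ k > 2n. *)
Lemma logn_central_binomial p n : prime p -> 0 < n ->
  p ^ logn p 'C(2 * n, n) <= 2 * n.
Proof.
move=> pr_p n0; have p1 := prime_gt1 pr_p.
have C0 : 0 < 'C(2 * n, n) by rewrite bin_gt0; lia.
apply: leq_trans (trunc_logP p1 (_ : 0 < 2 * n)); last by lia.
rewrite leq_exp2l // -(leq_add2r (2 * logn p n`!)).
have -> : logn p 'C(2 * n, n) + 2 * logn p n`! = logn p (2 * n)`!.
  rewrite -(@bin_fact (2 * n) n); last by lia.
  rewrite (_ : 2 * n - n = n); last by lia.
  by rewrite !lognM ?muln_gt0 ?fact_gt0 ?C0 //; lia.
have -> : logn p n`! = \sum_(1 <= k < (2 * n).+1) n %/ p ^ k.
  rewrite logn_fact // [RHS](big_cat_nat (n := n.+1)) //=; try lia.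
  rewrite -[LHS]addn0; congr (_ + _); rewrite big_nat big1 // => k /andP[lt_nk _].
  by rewrite divn_small // (ltn_trans lt_nk) // ltn_expl.
rewrite logn_fact // big_distrr /=.
set L := trunc_log p (2 * n).
have -> : L = \sum_(1 <= k < (2 * n).+1) (k <= L).
  have le_L : L <= 2 * n by rewrite (leq_trans (ltnW (ltn_expl L p1))) // trunc_logP //; lia.
  rewrite (big_cat_nat (n := L.+1)) //= -[LHS]addn0; congr (_ + _).
    rewrite -[LHS]muln1 -[L in LHS](subn1 L.+1) -sum_nat_const_nat.
    by apply: eq_big_nat => k /andP[_]; rewrite ltnS => ->.
  by rewrite big_nat big1 // => k /andP[]; rewrite ltnNge; case: (k <= L).
rewrite -big_split /=; apply: leq_sum => k _.
have [le_kL|lt_Lk] := leqP k L.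
  by rewrite add1n divn_double_le // expn_gt0 prime_gt0.
rewrite divn_small // (leq_trans (trunc_log_ltn _ p1)) //.
by rewrite leq_pexp2l ?prime_gt0.
Qed.


Lemma leq_prod_seq (I : eqType) (s : seq I) (f : I -> nat) b :
  {in s, forall i, f i <= b} -> \prod_(i <- s) f i <= b ^ size s.
Proof.
move=> le_fb; rewrite -iter_muln_1 -count_predT -big_const_seq big_seq [X in _ <= X]big_seq.
exact: leq_prod.
Qed.

(** The prime powers exactly dividing 'C(2n, n) >= 2 ^ n are at most 2n, so
    'C(2n, n) has more than Y + m prime factors, of which at most Y are not
    greater than Y. *)
Lemma many_primes n m Y : 0 < n -> (2 * n) ^ (Y + m) < 2 ^ n ->
  exists ps : seq nat, [/\ size ps = m, uniq ps &
    forall p, p \in ps -> [&& prime p, Y < p & p <= 2 * n]].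
Proof.
move=> n0 big_n; set C := 'C(2 * n, n).
have C0 : 0 < C by rewrite bin_gt0; lia.
have le_pow p : p \in primes C -> p ^ logn p C <= 2 * n.
  by rewrite mem_primes => /and3P[pr_p _ _]; apply: logn_central_binomial.
have le_p p : p \in primes C -> p <= 2 * n.
  move=> pC; apply: leq_trans (le_pow p pC).
  move: pC; rewrite -logn_gt0 -{2}[p]expn1 => lg.
  by rewrite leq_pexp2l //; case: p lg => //; rewrite lognE.
have le_C : C <= (2 * n) ^ size (primes C).
  rewrite [X in X <= _](prod_prime_decomp C0) prime_decompE big_map /=.
  exact: leq_prod_seq.
have lt_size : Y + m < size (primes C).
  rewrite -(@ltn_exp2l (2 * n)); last by lia.
  exact: leq_trans big_n (leq_trans (central_binomial_ge n) le_C).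
pose s := [seq p <- primes C | Y < p].
have le_s : m <= size s.
  have := count_predC (fun p => Y < p) (primes C).
  rewrite -size_filter -/s.
  suff : count (predC (fun p => Y < p)) (primes C) <= Y by lia.
  rewrite -size_filter -[X in _ <= X](size_iota 1 Y).
  apply: uniq_leq_size => [|p]; first by rewrite filter_uniq ?primes_uniq.
  rewrite mem_filter mem_primes mem_iota /= => /and3P[H pr_p _].
  by have := prime_gt0 pr_p; lia.
exists (take m s); split; first by rewrite size_takel.
  by rewrite take_uniq ?filter_uniq ?primes_uniq.
move=> p /mem_take; rewrite mem_filter => /andP[-> pC]; rewrite le_p // andbT.
by move: pC; rewrite mem_primes => /and3P[->].
Qed.

(** * Residue classes under the binomial law *)

(** The subtraction is truncated, so only the descent from the peak f M
    counts. *)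
Lemma sum_decrease_unimodal (f : nat -> nat) M n :
  (forall x, x < M -> f x <= f x.+1) -> (forall x, M <= x -> f x.+1 <= f x) ->
  \sum_(0 <= x < n) (f x - f x.+1) <= f M.
Proof.
move=> incr decr.
have low k : k <= M -> \sum_(0 <= x < k) (f x - f x.+1) = 0.
  move=> le_kM; rewrite big_nat big1 // => x /andP[_ lt_xk]; apply/eqP.
  by apply: incr; apply: leq_trans le_kM.
have [le_nM|/ltnW le_Mn] := leqP n M; first by rewrite low.
rewrite -(subnKC le_Mn); set j := n - M.
suff : \sum_(0 <= x < M + j) (f x - f x.+1) + f (M + j) <= f M by lia.
elim: j => [|j IHj]; first by rewrite addn0 low.
rewrite addnS big_nat_recr //=.
by have := decr (M + j) (leq_addr _ _); lia.
Qed.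

(** Q times the value at a point of the class exceeds the sum over the block of
    length Q starting there by at most Q times the descent of f on that block,
    and the total descent is at most f M. *)
Lemma unimodal_residue_sum (f : nat -> nat) M Q r J :
  (forall x, x < M -> f x <= f x.+1) -> (forall x, M <= x -> f x.+1 <= f x) ->
  Q * (\sum_(0 <= j < J) f (r + j * Q)) <=
  \sum_(0 <= x < r + J * Q) f x + Q * f M.
Proof.
move=> incr decr.
have step x t : f x <= f (x + t) + \sum_(x <= y < x + t) (f y - f y.+1).
  elim: t => [|t IHt]; first by rewrite addn0 leq_addr.
  by rewrite addnS big_nat_recr ?leq_addr //=; lia.
have block x : Q * f x <= \sum_(x <= y < x + Q) f y + Q * \sum_(x <= y < x + Q) (f y - f y.+1).
  have -> : \sum_(x <= y < x + Q) f y = \sum_(0 <= t < Q) f (x + t).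
    by rewrite -{1}[x]add0n big_addn addKn; apply: eq_bigr => t _; rewrite addnC.
  rewrite -[Q in Q * f x]subn0 -[Q in Q * bigop.body _ _ _]subn0 -!sum_nat_const_nat -big_split /=.
  rewrite big_nat [X in _ <= X]big_nat; apply: leq_sum => t /andP[_ lt_tQ].
  apply: leq_trans (step x t) _; rewrite leq_add2l.
  by rewrite [X in _ <= X](big_cat_nat (n := x + t)) ?leq_addr ?leq_add2l ?(ltnW lt_tQ).
suff : Q * (\sum_(0 <= j < J) f (r + j * Q)) <= \sum_(r <= x < r + J * Q) f x +
    Q * \sum_(r <= x < r + J * Q) (f x - f x.+1).
  move=> H; apply: leq_trans H (leq_add _ _).
    by rewrite [X in _ <= X](big_cat_nat (n := r)) ?leq_addr ?leq_addl.
  rewrite leq_mul // (leq_trans _ (sum_decrease_unimodal (r + J * Q) incr decr)) //.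
  by rewrite [X in _ <= X](big_cat_nat (n := r)) ?leq_addr ?leq_addl.
elim: J => [|J IHJ]; first by rewrite big_geq // muln0.
rewrite big_nat_recr //= mulnDr.
rewrite ![\sum_(r <= x < r + J.+1 * Q) _](big_cat_nat (n := r + J * Q)) ?leq_addr ?leq_add2l ?leq_mul //=.
have := block (r + J * Q); rewrite -addnA [J * Q + Q]addnC -mulSn.
by move: IHJ; rewrite mulnDr; lia.
Qed.

Lemma binomial_increasing n x : x < n -> 'C(2 * n, x) <= 'C(2 * n, x.+1).
Proof. by move=> lt_xn; have := mul_bin_left (2 * n) x; nia. Qed.

Lemma binomial_decreasing n x : n <= x -> 'C(2 * n, x.+1) <= 'C(2 * n, x).
Proof. by move=> le_nx; have := mul_bin_left (2 * n) x; nia. Qed.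

Lemma sum_binomial_le N K : \sum_(0 <= x < K) 'C(N, x) <= 2 ^ N.
Proof.
have -> : 2 ^ N = \sum_(0 <= x < N.+1) 'C(N, x).
  rewrite -[2]/(1 + 1) expnDn big_mkord; apply: eq_bigr => i _.
  by rewrite !exp1n !muln1.
have [le_KN|/ltnW le_NK] := leqP K N.+1.
  by rewrite [X in _ <= X](big_cat_nat (n := K)) ?leq_addr.
rewrite (big_cat_nat (n := N.+1)) //= -[X in _ <= X]addn0 leq_add2l leqn0.
by rewrite big_nat big1 // => x /andP[lt_Nx _]; rewrite bin_small.
Qed.

Lemma sum_residue_class_le (f : nat -> nat) Q r A :
  \sum_(0 <= x < A | x %% Q == r) f x <= \sum_(0 <= j < A) f (r + j * Q).
Proof.
apply: (@leq_trans (\sum_(0 <= x < A) \sum_(0 <= j < A) (x == r + j * Q) * f (r + j * Q))).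
  rewrite big_mkcond big_nat [X in _ <= X]big_nat; apply: leq_sum => x /andP[_ lt_xA].
  case: eqP => // Er; have {2}-> : x = r + x %/ Q * Q by rewrite {1}(divn_eq x Q) Er addnC.
  rewrite (bigD1_seq (x %/ Q)) ?iota_uniq //=; last first.
    by rewrite mem_index_iota (leq_ltn_trans (leq_div _ _)).
  by rewrite {1}(divn_eq x Q) Er addnC eqxx mul1n leq_addr.
rewrite exchange_big /=; apply: leq_sum => j _; rewrite -big_distrl /=.
rewrite -[X in _ <= X]mul1n leq_mul2r; apply/orP; right.
by rewrite -big_mkcond /= sum1_count count_uniq_mem ?iota_uniq // leq_b1.
Qed.

Lemma binomial_residue_sum n Q r :
  Q * (\sum_(0 <= x < (2 * n).+1 | x %% Q == r) 'C(2 * n, x)) <=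
  2 ^ (2 * n) + Q * 'C(2 * n, n).
Proof.
apply: leq_trans (leq_mul (leqnn Q) (sum_residue_class_le _ _ _ _)) _.
apply: leq_trans (unimodal_residue_sum Q r _ (@binomial_increasing n) (@binomial_decreasing n)) _.
by rewrite leq_add2r sum_binomial_le.
Qed.

(** * Choice of the primes *)

(** With m = 16 L primes, the exponents compared in [prime_range_large] and
    [modulus_small] are quadratic in L = log_2 d, against d >= 2 ^ L.  The
    inequality fails at L = 11, whence the threshold d >= 2 ^ 12 below. *)
Lemma quadratic_le_exp L : 12 <= L -> 32 * (L * L) + 49 * L + 2 <= 2 ^ L.+1.
Proof.
move=> le12; rewrite -(subnKC le12); elim: (L - 12) => [|n IHn].
  by apply/ssrnat.leP/PeanoNat.Nat.leb_le.
by rewrite addnS expnS; move: IHn; set E := 2 ^ _; nia.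
Qed.

Section Sizes.
Variables (d : nat).
Hypothesis d_large : 2 ^ 12 <= d.
Let L := trunc_log 2 d.

Let d_gt0 : 0 < d. Proof. exact: leq_trans d_large. Qed.

Lemma log_large : 12 <= L. Proof. exact: trunc_log_max. Qed.

Let quadratic_le_d : 32 * (L * L) + 49 * L + 2 <= 2 * d.
Proof.
apply: leq_trans (quadratic_le_exp log_large) _.
by rewrite expnS leq_mul // trunc_logP.
Qed.

Let two_dd_le : 2 * (d * d) <= 2 ^ (2 * L + 3).
Proof.
have lt_d : d < 2 ^ L.+1 by exact: trunc_log_ltn.
have -> : 2 ^ (2 * L + 3) = 2 * (2 ^ L.+1 * 2 ^ L.+1).
  by rewrite -expnD -expnS; congr (2 ^ _); lia.
by rewrite leq_mul // leq_mul // ltnW.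
Qed.

Lemma prime_range_large : (2 * (d * d)) ^ (2 * d + 16 * L) < 2 ^ (d * d).
Proof.
apply: (@leq_ltn_trans ((2 ^ (2 * L + 3)) ^ (2 * d + 16 * L))).
  by rewrite leq_exp2r //; lia.
rewrite -expnM ltn_exp2l //; have := log_large; move: quadratic_le_d.
by nia.
Qed.

Lemma modulus_small : 2 * d * (2 * (d * d)) ^ (16 * L) <= 4 ^ d.
Proof.
apply: (@leq_trans (2 ^ (L + 2) * (2 ^ (2 * L + 3)) ^ (16 * L))).
  apply: leq_mul; last first.
    by rewrite leq_exp2r //; have := log_large; lia.
  rewrite addn2 expnS leq_mul //; exact/ltnW/trunc_log_ltn.
rewrite -expnM -expnD -[4]/(2 ^ 2) -expnM leq_exp2l //.
by have := quadratic_le_d; nia.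
Qed.

End Sizes.

(** * Reduction modulo several primes *)

Definition depends_mod (d Q : nat) (A : ('I_d -> nat) -> bool) : Prop :=
  forall c c' : 'I_d -> nat, (forall i, c i = c' i %[mod Q]) -> A c = A c'.

Definition residue_count (d Q : nat) (A : ('I_d -> nat) -> bool) : nat :=
  #|[set c : {ffun 'I_d -> 'I_Q} | A (fun i => c i)]|.

(** By the Chinese remainder theorem, a vector modulo Q * p is determined by its
    reductions modulo Q and modulo p. *)
Lemma residue_count_mul d Q p (A B : ('I_d -> nat) -> bool) :
  0 < Q -> 0 < p -> coprime Q p -> depends_mod Q A -> depends_mod p B ->
  residue_count (Q * p) (fun c => A c && B c) <= residue_count Q A * residue_count p B.
Proof.
move=> Q0 p0 cop mA mB; rewrite /residue_count -cardsX.
pose red (m : nat) (m0 : 0 < m) (c : {ffun 'I_d -> 'I_(Q * p)}) : {ffun 'I_d -> 'I_m} :=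
  [ffun i => Ordinal (ltn_pmod (c i) m0)].
pose h c := (red Q Q0 c, red p p0 c).
have inj_h : injective h.
  move=> c c' [/ffunP EQ /ffunP Ep]; apply/ffunP => i; apply/val_inj => /=.
  have /eqP := congr1 val (EQ i); have /eqP := congr1 val (Ep i); rewrite !ffunE /= => E1 E2.
  have : c i == c' i %[mod Q * p] by rewrite chinese_remainder // E1 E2.
  by rewrite !modn_small // => /eqP.
rewrite -(card_imset _ inj_h); apply/subset_leq_card/fintype.subsetP => x /imsetP[c + ->].
rewrite !inE => /andP[Ac Bc]; apply/andP; split.
  by rewrite -(mA (fun i => c i)) // => i; rewrite ffunE /= modn_mod.
by rewrite -(mB (fun i => c i)) // => i; rewrite ffunE /= modn_mod.
Qed.

Lemma coprime_prod_primes p (ps : seq nat) :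
  prime p -> {in ps, forall p', prime p'} -> p \notin ps ->
  coprime (\prod_(p' <- ps) p') p.
Proof.
move=> pr_p; elim: ps => [|p' ps IHps] pr_ps; first by rewrite big_nil coprime1n.
rewrite inE negb_or => /andP[ne nps]; rewrite big_cons coprimeMl IHps ?andbT //.
  by rewrite coprime_sym prime_coprime // dvdn_prime2 // pr_ps // mem_head.
by move=> r rs; apply: pr_ps; rewrite inE rs orbT.
Qed.

Lemma residue_count_prod d (B : nat -> ('I_d -> nat) -> bool) (ps : seq nat) :
  uniq ps -> {in ps, forall p, prime p} -> (forall p, depends_mod p (B p)) ->
  residue_count (\prod_(p <- ps) p) (fun c => all (B^~ c) ps) <=
  \prod_(p <- ps) residue_count p (B p).
Proof.
move=> + + mB; elim: ps => [|p ps IHps] /= => [_ _|/andP[nps ups] pr_ps].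
  rewrite !big_nil /residue_count; apply: leq_trans (max_card _) _.
  by rewrite card_ffun card_ord exp1n.
have pr_s : {in ps, forall p', prime p'} by move=> r rs; apply: pr_ps; rewrite inE rs orbT.
have pr_p : prime p by apply: pr_ps; exact: mem_head.
rewrite !big_cons; have := IHps ups pr_s.
move=> /(leq_mul (leqnn (residue_count p (B p)))); apply: leq_trans.
apply: residue_count_mul => //.
- exact: prime_gt0.
- by rewrite big_seq prodn_cond_gt0 // => r rs; exact: prime_gt0 (pr_s r rs).
- by rewrite coprime_sym coprime_prod_primes.
- move=> c c' E; apply: eq_in_all => r rs; apply: mB => i; apply/eqP.
  have dvr : r %| \prod_(r <- ps) r by rewrite (big_rem r) //= dvdn_mulr.
  have := E i => /eqP.
  have [le|/ltnW le] := leqP (c i) (c' i).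
    by rewrite eq_sym [in X in _ -> X]eq_sym !eqn_mod_dvd // => /(dvdn_trans dvr).
  by rewrite !eqn_mod_dvd // => /(dvdn_trans dvr).
Qed.

Definition splits_mod (d k p : nat) (c : 'I_d -> nat) : bool :=
  ~~ no_divisor k (monic_poly (fun i => (c i)%:R : 'F_p)%R).

Lemma natr_Fp_mod p (x y : nat) : prime p -> x = y %[mod p] -> (x%:R = y%:R :> 'F_p)%R.
Proof.
by move=> pr_p E; rewrite -(Fp_nat_mod pr_p x) E Fp_nat_mod.
Qed.

Lemma splits_mod_depends d k p : prime p -> depends_mod p (@splits_mod d k p).
Proof.
move=> pr_p c c' E; rewrite /splits_mod; congr (~~ no_divisor _ _).
by apply: eq_monic_poly => i; exact: natr_Fp_mod.
Qed.

Lemma splits_mod_count d k p : prime p -> 0 < k -> 2 * k <= d -> 2 * d <= p ->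
  8 * residue_count p (@splits_mod d k p) <= 7 * p ^ d.
Proof.
move=> pr_p k0 le_kd le_dp; have p4 : 4 <= p by lia.
have := @count_no_divisor_ge 'F_p k d k0 le_kd; rewrite card_Fp // => /(_ p4 le_dp).
have := count_predC (no_divisor k) (monics 'F_p d); rewrite size_monics card_Fp //.
suff : residue_count p (@splits_mod d k p) <= count (predC (no_divisor k)) (monics 'F_p d).
  by lia.
rewrite count_map -size_filter /residue_count.
pose h (c : {ffun 'I_d -> 'I_p}) : {ffun 'I_d -> 'F_p} := [ffun i => (c i)%:R%R].
have inj_h : injective h.
  move=> c c' /ffunP E; apply/ffunP => i; apply/val_inj => /=.
  have := congr1 val (E i); rewrite !ffunE /= !val_Fp_nat //.
  by rewrite !modn_small.
rewrite -(card_imset _ inj_h) -[size _]/(size _).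
rewrite (_ : size _ = #|[pred c : {ffun 'I_d -> 'F_p} | ~~ no_divisor k (monic_poly c)]|); last first.
  by rewrite cardE /enum_mem -filter_predI; congr (size _); apply: eq_filter => c /=; rewrite !inE andbT.
apply/subset_leq_card/fintype.subsetP => x /imsetP[c + ->]; rewrite !inE /splits_mod /=.
set P := monic_poly _; set P' := monic_poly _; suff -> : P' = P by [].
by apply: eq_monic_poly => i; rewrite ffunE.
Qed.

(** Independence modulo distinct primes: each prime contributes a factor at
    most 7/8, by [count_no_divisor_ge]. *)
Lemma splits_mod_all_count d k (ps : seq nat) : 0 < k -> 2 * k <= d ->
  uniq ps -> {in ps, forall p, prime p && (2 * d <= p)} ->
  8 ^ size ps * residue_count (\prod_(p <- ps) p) (fun c => all (fun p => @splits_mod d k p c) ps)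
  <= 7 ^ size ps * (\prod_(p <- ps) p) ^ d.
Proof.
move=> k0 le_kd ups Hps.
(* [residue_count_prod] asks for dependence modulo p at every p. *)
pose B p := if prime p then @splits_mod d k p else fun=> false.
have -> : residue_count (\prod_(p <- ps) p) (fun c => all (fun p => @splits_mod d k p c) ps) =
          residue_count (\prod_(p <- ps) p) (fun c => all (B^~ c) ps).
  apply: eq_card => c; rewrite !inE; apply: eq_in_all => p /Hps/andP[pr_p _].
  by rewrite /B pr_p.
apply: (@leq_trans (8 ^ size ps * \prod_(p <- ps) residue_count p (B p))).
  rewrite leq_mul // residue_count_prod // => [p /Hps/andP[]//|p].
  by rewrite /B; case: ifP => // /splits_mod_depends.
elim: ps ups Hps => [|p ps IHps] /= => [_ _|/andP[_ ups] Hps].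
  by rewrite !big_nil exp1n.
have /andP[pr_p le_dp] := Hps p (mem_head _ _).
have IH := IHps ups (fun r rs => Hps r (mem_behead (s := p :: ps) rs)).
have := leq_mul (splits_mod_count pr_p k0 le_kd le_dp) IH.
rewrite !big_cons !expnS expnMn /B pr_p.
set R := residue_count _ _; set S := bigop.body _ _ _; set T := bigop.body _ _ _.
by rewrite [8 * R * _]mulnACA [7 * _ * _]mulnACA.
Qed.

Local Open Scope classical_set_scope.
Local Open Scope ring_scope.

(** * From a factorization over the integers to divisors modulo primes *)

(** The definition of reducibility only bounds the degrees of the factors from
    above, so some of them may be constants; a nonconstant one is split off, and
    its cofactor is nonconstant since that factor has degree less than d. *)
Lemma reducible_factors d (f : {poly int}) : (0 < d)%N -> size f = d.+1 ->
  ~ irreducible_over_Z f ->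
  exists g h : {poly int}, [/\ f = g * h, (1 < size g)%N & (1 < size h)%N].
Proof.
move=> d0 sf /contrapT[s [s2 small fE]].
have f0 : f != 0 by rewrite -size_poly_gt0 sf.
have [g gs sg] : exists2 g, g \in s & (1 < size g)%N.
  apply/hasP; apply: contraT => /hasPn const.
  suff : (size f <= 1)%N by rewrite sf ltnS leqNgt d0.
  rewrite fE big_seq; apply: (big_ind (fun p : {poly int} => (size p <= 1)%N)).
  - by rewrite size_poly1.
  - by move=> p q /size1_polyC-> /size1_polyC->; rewrite -polyCM size_polyC leq_b1.
  - by move=> p /const; rewrite -leqNgt.
pose h := \prod_(p <- rem g s) p.
have fgh : f = g * h by rewrite fE (big_rem g).
exists g, h; split=> //.
have := small g gs; rewrite {1}fgh size_mul; last 2 first.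
- by apply: contraNneq f0 => g0; rewrite fgh g0 mul0r.
- by apply: contraNneq f0 => h0; rewrite fgh h0 mulr0.
by move: sg; set x := size g; set y := size h; clear; lia.
Qed.

(** The smaller of two complementary factors; its leading coefficient is a unit
    because f is monic, which preserves its degree under reduction modulo any
    prime. *)
Lemma reducible_small_factor d (f : {poly int}) : (0 < d)%N -> f \is monic -> size f = d.+1 ->
  ~ irreducible_over_Z f ->
  exists k (g : {poly int}), [/\ (0 < k)%N, (2 * k <= d)%N, size g = k.+1,
     lead_coef g \is a GRing.unit & exists h, f = g * h].
Proof.
move=> d0 fm sf /(reducible_factors d0 sf)[g [h [fE sg sh]]].
wlog le_gh : g h fE sg sh / (size g <= size h)%N.
  move=> W; have [le|/ltnW le] := leqP (size g) (size h); first exact: (W g h).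
  by apply: (W h g) => //; rewrite mulrC.
have lc : lead_coef g * lead_coef h = 1 by rewrite -lead_coefM -fE (monicP fm).
have sgh : (size g + size h = d.+2)%N.
  have g0 : g != 0 by rewrite -size_poly_gt0 ltnW.
  have h0 : h != 0 by rewrite -size_poly_gt0 ltnW.
  move: sf; rewrite fE size_mul // => <-; rewrite prednK //.
  by rewrite addn_gt0 ltnW.
exists (size g).-1, g; split.
- by move: sg; case: (size g).
- by move: sgh le_gh sg; set x := size g; set y := size h; clear; lia.
- by rewrite prednK // ltnW.
- by apply/unitrPr; exists (lead_coef h).
- by exists h.
Qed.

Lemma map_monic_poly (R S : nzRingType) (phi : {rmorphism R -> S}) d (c : 'I_d -> R) :
  map_poly phi (monic_poly c) = monic_poly (phi \o c).
Proof.
rewrite /monic_poly rmorphD /= map_polyXn rmorph_sum /=; congr (_ + _).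
by apply: eq_bigr => i _; rewrite map_polyZ map_polyXn.
Qed.

Lemma int_residue_Fp (Q p : nat) (z : int) (r : nat) : prime p -> (p %| Q)%N ->
  (z %% Q)%Z = r -> z%:~R = r%:R :> 'F_p.
Proof.
move=> pr_p pQ zr; rewrite [z](divz_eq _ Q) zr rmorphD rmorphM /= -!pmulrn.
suff -> : Q%:R = 0 :> 'F_p by rewrite mulr0 add0r.
by apply/val_inj; rewrite /= val_Fp_nat // (eqP pQ).
Qed.

Lemma reducible_splits d (Q : nat) (c : 'I_d -> int) (r : 'I_d -> nat) :
  (0 < d)%N -> (forall i, (c i %% Q)%Z = r i) -> ~ irreducible_over_Z (monic_of_coefs c) ->
  exists k, [/\ (0 < k)%N, (2 * k <= d)%N &
    forall p, prime p -> (p %| Q)%N -> @splits_mod d k p r].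
Proof.
move=> d0 cr /(reducible_small_factor d0 (monic_monic_poly c) (size_monic_poly c)).
case=> k [g [k0 kd sg lg [h fE]]]; exists k; split=> // p pr_p pQ.
apply/negP => /no_divisorP/(_ (map_poly intr g)).
rewrite size_map_poly_id0; last by rewrite -unitfE rmorph_unit.
move=> /(_ sg)/negP; apply.
have -> : monic_poly (fun i => (r i)%:R : 'F_p) = map_poly intr (monic_poly c).
  rewrite map_monic_poly; apply: eq_monic_poly => i /=.
  by rewrite (int_residue_Fp pr_p pQ (cr i)).
by rewrite [monic_poly c]fE rmorphM /= dvdp_mulIl.
Qed.

(** * Probability estimates *)

Section Binomial.
Variable R : realType.
Local Open Scope classical_set_scope.

Lemma binomial_prob_residue n Q r : (0 < Q)%N ->
  (binomial_prob (2 * n) (2^-1 : R) [set x | (x %% Q)%N = r] <=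
   (Q%:R^-1 + 'C(2 * n, n)%:R / 2 ^+ (2 * n))%:E)%E.
Proof.
move=> Q0.
have p0 : 0 <= 2^-1 :> R by [].
have p1 : ((NngNum p0)%:num <= 1)%R by rewrite /=; lra.
have := binomial_probE (2 * n) p1 [set x | (x %% Q)%N = r]; rewrite /= => ->.
have -> : (\sum_(k < (2 * n).+1) (bin_prob (2 * n) p1 k)%:num%:E * \d_(k : nat) [set x | (x %% Q)%N = r])%E
  = ((\sum_(0 <= x < (2 * n).+1 | (x %% Q == r)%N) 'C(2 * n, x))%:R / 2 ^+ (2 * n))%:E.
  rewrite big_mkord natr_sum mulr_suml -sumEFin [RHS]big_mkcond /=.
  apply: eq_bigr => k _; rewrite diracE /=.
  case: eqP => [e|ne]; last by rewrite memNset // mule0.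
  rewrite mem_set // mule1; congr (_%:E).
  have -> : unstable.onem (2^-1 : R) = 2^-1 by rewrite /unstable.onem; field.
  have le_k : (k <= 2 * n)%N by rewrite -ltnS.
  by rewrite -exprD subnKC // exprVn mulr_natl.
rewrite lee_fin; set S := bigop.body _ _ _; set K := 'C(_, _).
have Q0' : 0 < Q%:R :> R by rewrite ltr0n.
have e0 : 0 < 2 ^+ (2 * n) :> R by rewrite exprn_gt0.
have : (Q * S)%:R <= (2 ^ (2 * n) + Q * K)%:R :> R by rewrite ler_nat binomial_residue_sum.
rewrite natrD !natrM natrX; move: (2 ^+ (2 * n)) e0 => E E0 H.
have -> : Q%:R^-1 + K%:R / E = (E + Q%:R * K%:R) / (Q%:R * E) :> R.
  by field; rewrite !gt_eqF.
rewrite ler_pdivlMr ?mulr_gt0 // (_ : _ * _ = Q%:R * S%:R) //.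
by field; rewrite gt_eqF.
Qed.

(** The square root of the number 16 ^ d of trials is 4 ^ d, so this is
    [central_binomial_sqr]. *)
Lemma central_binomial_ratio d : (0 < d)%N ->
  exists2 n, (4 ^ (2 * d) = 2 * n)%N & 'C(2 * n, n)%:R / 2 ^+ (2 * n) <= (4 ^+ d)^-1 :> R.
Proof.
case: d => // d _; exists (8 * 16 ^ d)%N.
  by rewrite expnM (expnS 16); lia.
set n := (8 * 16 ^ d)%N.
have N16 : (2 * n = 16 ^ d.+1)%N by rewrite expnS /n; lia.
rewrite ler_pdivrMr ?exprn_gt0 // -ler_pdivrMl ?invr_gt0 ?exprn_gt0 // invrK.
rewrite -[4]/(4%:R) -!natrX -natrM ler_nat -leq_sqr.
apply: leq_trans (_ : (2 * n).+1 * 'C(2 * n, n) ^ 2 <= _)%N.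
  by rewrite expnMn leq_mul // N16 -expnM mulnC expnM.
by rewrite mulnC -expnM (mulnC _ 2) mulnCA [X in (_ <= X)%N](_ : _ = 16 ^ n)%N ?central_binomial_sqr // (mulnA 2 2) expnM.
Qed.
End Binomial.

Section Probability.
Context (R : realType) (disp : measure_display) (T : measurableType disp) (P : probability T R).

Lemma union_bound (I : finType) (J : pred I) (A : I -> set T) (b : I -> R) :
  (forall i, measurable (A i)) -> (forall i, J i -> (P (A i) <= (b i)%:E)%E) ->
  measurable (\big[setU/set0]_(i | J i) A i) /\
  (P (\big[setU/set0]_(i | J i) A i) <= (\sum_(i | J i) b i)%:E)%E.
Proof.
move=> mA Ab.
apply: (big_ind2 (fun (X : set T) x => measurable X /\ (P X <= x%:E)%E)).
- by rewrite measure0.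
- move=> X x Y y [mX Xx] [mY Yy]; split; first exact: measurableU.
  by rewrite EFinD (le_trans (measureU2 _ mX mY)) // leeD.
- by move=> i Ji; split; [exact: mA|exact: Ab].
Qed.

(** The centering only shifts the residue class. *)
Lemma binomial_residue_prob d Q (a : {RV P >-> int}) (r : int) : (0 < d)%N -> (0 < Q)%N ->
  centered_binomial (4 ^ (2 * d)) a ->
  (P (a @^-1` [set z | (z %% Q)%Z = r]) <= (Q%:R^-1 + (4 ^+ d)^-1)%:E)%E.
Proof.
move=> d0 Q0 [X [distX aX]].
have [n nE ratio] := central_binomial_ratio R d0.
pose r' := (absz ((r + (4 ^ (2 * d))./2%:Z) %% Q)%Z)%N.
apply: (@le_trans _ _ (P (X @^-1` [set x | (x %% Q)%N = r']))).
  apply: le_measure; rewrite ?inE; try exact: measurable_funPTI.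
  move=> w /=; rewrite aX /r' => <-; apply/eqP.
  have Qn0 : Q%:Z != 0 by rewrite eqz_nat -lt0n.
  by rewrite -eqz_nat abszE ger0_norm ?modz_ge0 // modzDml subrK modz_nat.
rewrite -[leLHS]/(distribution P X _) distX nE.
apply: le_trans (binomial_prob_residue R n r' Q0) _.
by rewrite lee_fin lerD2l.
Qed.

Lemma independent_residues_prob d (a : 'I_d -> {RV P >-> int}) (B : 'I_d -> set int) (b : R) :
  mutually_independent a -> (forall i, (P (a i @^-1` B i) <= b%:E)%E) ->
  (P (\bigcap_(i in [set: 'I_d]) (a i @^-1` B i)) <= (b ^+ d)%:E)%E.
Proof.
move=> indep Bb.
have := indep [set: 'I_d]%SET B (fun _ _ => I).
rewrite (_ : [set` _] = [set: 'I_d]); last by apply/seteqP; split=> // i _; rewrite /= inE.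
move=> ->.
have -> : (b ^+ d)%:E = (\prod_(i in [set: 'I_d]%SET) b%:E)%E.
  by rewrite prodEFin prodr_const cardsT card_ord.
suff : (0 <= \prod_(i in [set: 'I_d]%SET) P (a i @^-1` B i) <= \prod_(i in [set: 'I_d]%SET) b%:E)%E.
  by case/andP.
apply: (big_ind2 (fun x y : \bar R => 0 <= x <= y)%E).
- by rewrite lexx lee01.
- by move=> x x' y y' /andP[x0 xx] /andP[y0 yy]; rewrite mule_ge0 //= lee_pmul.
- by move=> i _; rewrite measure_ge0 Bb.
Qed.

(** The event is a countable union, over the possible vectors of coefficients,
    of cylinders. *)
Lemma measurable_coefs_event d (a : 'I_d -> {RV P >-> int}) (E : {poly int} -> Prop) :
  measurable [set w : T | E (monic_of_coefs (fun i => a i w))].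
Proof.
have -> : [set w : T | E (monic_of_coefs (fun i => a i w))] =
  \bigcup_(c : {ffun 'I_d -> int})
    (if `[< E (monic_of_coefs c) >] then \bigcap_(i in [set: 'I_d]) (a i @^-1` [set c i]) else set0).
  have coefs_eq w (c : {ffun 'I_d -> int}) : (forall i, a i w = c i) ->
      monic_of_coefs (fun i => a i w) = monic_of_coefs c.
    exact: eq_monic_poly.
  apply/seteqP; split=> [w Ew|w [c _]].
    pose c := [ffun i => a i w]; have ac i : a i w = c i by rewrite ffunE.
    exists c => //=; rewrite -(coefs_eq w c ac) asboolT // => i _ /=; exact: ac.
  by case: asboolP => //= Ec aw; rewrite /mkset (coefs_eq w c) // => i; exact: aw.
apply: countable_bigcupT_measurable; first exact: countableP.
move=> c; case: ifP => _; last exact: measurable0.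
by apply: fin_bigcap_measurable => // i _; exact: measurable_funPTI.
Qed.

End Probability.

(** The induction proves (1 + 1 / (2d)) ^ j <= 1 + j / d for j <= d. *)
Lemma expr_succ_ratio_le2 (R : realType) d : (0 < d)%N ->
  (1 + (2 * d%:R)^-1) ^+ d <= 2 :> R.
Proof.
move=> d0; have d0' : 0 < d%:R :> R by rewrite ltr0n.
suff H j : (j <= d)%N -> (1 + (2 * d%:R)^-1) ^+ j <= 1 + j%:R / d%:R :> R.
  by have := H d (leqnn d); rewrite divff ?gt_eqF // -[1 + 1]/(2%:R).
elim: j => [|j IHj] le_jd; first by rewrite expr0 mul0r addr0.
have jd : j%:R <= d%:R :> R by rewrite ler_nat ltnW.
rewrite exprSr; apply: le_trans (ler_wpM2r _ (IHj (ltnW le_jd))) _.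
  by rewrite addr_ge0 // invr_ge0 mulr_ge0 // ltW.
rewrite -subr_ge0 -natr1.
have -> : 1 + (j%:R + 1) / d%:R - (1 + j%:R / d%:R) * (1 + (2 * d%:R)^-1) =
   (d%:R - j%:R) / (2 * d%:R ^+ 2) :> R by field; rewrite gt_eqF.
by rewrite divr_ge0 ?subr_ge0 // mulr_ge0 // exprn_ge0 // ltW.
Qed.

(** N bad residue vectors modulo Q, at most a proportion (7/8) ^ m of all of
    them, carry at most twice their uniform mass: (1/Q + 4 ^- d) ^ d is at most
    ((1 + 1 / (2d)) / Q) ^ d <= 2 / Q ^ d. *)
Lemma bad_class_mass (R : realType) d Q m N : (0 < d)%N -> (0 < Q)%N ->
  (2 * d * Q <= 4 ^ d)%N -> (8 ^ m * N <= 7 ^ m * Q ^ d)%N ->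
  N%:R * (Q%:R^-1 + (4 ^+ d)^-1) ^+ d <= 2 * (7 / 8) ^+ m :> R.
Proof.
move=> d0 Q0 le_Q le_N.
have d0' : 0 < d%:R :> R by rewrite ltr0n.
have Q0' : 0 < Q%:R :> R by rewrite ltr0n.
have le_b : Q%:R^-1 + (4 ^+ d)^-1 <= (1 + (2 * d%:R)^-1) / Q%:R :> R.
  rewrite mulrDl mul1r lerD2l -invfM lef_pV2 ?posrE ?exprn_gt0 ?mulr_gt0 //.
  by rewrite -[2]/(2%:R) -[4]/(4%:R) -!natrM -natrX ler_nat.
have b0 : 0 <= Q%:R^-1 + (4 ^+ d)^-1 :> R by rewrite addr_ge0 // invr_ge0 ?exprn_ge0 // ltW.
have le_N' : N%:R <= (7 / 8) ^+ m * Q%:R ^+ d :> R.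
  rewrite exprMn exprVn mulrAC ler_pdivlMr ?exprn_gt0 //.
  by rewrite -[8]/(8%:R) -[7]/(7%:R) -!natrX -!natrM ler_nat mulnC.
apply: (@le_trans _ _ ((7 / 8) ^+ m * Q%:R ^+ d * ((1 + (2 * d%:R)^-1) / Q%:R) ^+ d)).
  by rewrite ler_pM // ?exprn_ge0 // lerXn2r // nnegrE (le_trans b0).
have -> : (7 / 8) ^+ m * Q%:R ^+ d * ((1 + (2 * d%:R)^-1) / Q%:R) ^+ d =
    (1 + (2 * d%:R)^-1) ^+ d * (7 / 8) ^+ m :> R.
  rewrite [((1 + _) / _) ^+ d]exprMn exprVn mulrCA mulfK //.
  by rewrite expf_neq0 ?gt_eqF.
by rewrite ler_wpM2r ?exprn_ge0 ?expr_succ_ratio_le2 // divr_ge0.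
Qed.

(** The constant 16 is chosen so that (7/8) ^ 16 <= 1/4: with L = log_2 d, the
    power (7/8) ^ (16 L) is at most 4 ^- L <= 4 / d ^ 2. *)
Lemma total_mass (R : realType) d : (2 ^ 12 <= d)%N ->
  d%:R * (2 * (7 / 8) ^+ (16 * trunc_log 2 d)) <= 16 / d.+1%:R :> R.
Proof.
move=> d_large; have d0 : (0 < d)%N by apply: leq_trans d_large.
have d0' : 1 <= d%:R :> R by rewrite ler1n.
set L := trunc_log 2 d.
have le_L : (7 / 8) ^+ (16 * L) <= (4 ^+ L)^-1 :> R.
  rewrite exprM -exprVn lerXn2r ?nnegrE ?exprn_ge0 ?invr_ge0 ?divr_ge0 //.
  have le2 : (7 / 8) ^+ 4 <= 3 / 5 :> R by rewrite !exprS expr0; lra.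
  rewrite (exprM _ 4 4); apply: (@le_trans _ _ ((3 / 5) ^+ 4)).
    by rewrite lerXn2r ?nnegrE ?exprn_ge0 ?divr_ge0.
  by rewrite !exprS expr0; lra.
have lt_d : (d * d <= 4 * 4 ^ L)%N.
  have lt : (d <= 2 ^ L.+1)%N by exact/ltnW/trunc_log_ltn.
  by apply: leq_trans (leq_mul lt lt) _; rewrite -expnMn -expnS.
have le_dd : d%:R * d%:R <= 4 * 4 ^+ L :> R.
  by rewrite -[4]/(4%:R) -natrX -!natrM ler_nat.
have E0 : 0 < 4 ^+ L :> R by rewrite exprn_gt0.
apply: (@le_trans _ _ (d%:R * (2 * (4 ^+ L)^-1))).
  by rewrite ler_wpM2l ?(le_trans ler01) // ler_wpM2l.
rewrite mulrA ler_pdivrMr // mulrAC ler_pdivlMr ?ltr0n // -natr1.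
by move: le_dd E0 d0'; set x := d%:R; set E := 4 ^+ L; nra.
Qed.

Section Bound.
Context (R : realType) (disp : measure_display) (T : measurableType disp) (P : probability T R).

(** Union bound over the degrees k <= d/2 and the vectors of residues modulo Q
    for which a divisor of degree k exists modulo all the primes dividing Q. *)
Lemma reducible_prob_le d (a : 'I_d -> {RV P >-> int}) : (2 ^ 12 <= d)%N ->
  mutually_independent a -> (forall i, centered_binomial (4 ^ (2 * d)) (a i)) ->
  (P [set w : T | ~ irreducible_over_Z (monic_of_coefs (fun i => a i w))] <=
   (16 / d.+1%:R)%:E)%E.
Proof.
move=> d_large indep binom; have d0 : (0 < d)%N by apply: leq_trans d_large.
set m := (16 * trunc_log 2 d)%N.
have dd0 : (0 < d * d)%N by rewrite muln_gt0 d0.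
have [ps [sz_ps u_ps Hps]] := many_primes dd0 (prime_range_large d_large).
set Q := (\prod_(p <- ps) p)%N.
have pr_ps : {in ps, forall p, prime p} by move=> p /Hps/and3P[].
have Q0 : (0 < Q)%N.
  by rewrite /Q big_seq prodn_cond_gt0 // => p ps_p; exact: prime_gt0 (pr_ps p ps_p).
have le_Q : (2 * d * Q <= 4 ^ d)%N.
  apply: leq_trans (modulus_small d_large); rewrite leq_mul // -sz_ps leq_prod_seq //.
  by move=> p /Hps/and3P[].
pose bad (k : nat) (c : {ffun 'I_d -> 'I_Q}) :=
  all (fun p => @splits_mod d k p (fun i => c i)) ps.
pose J (kc : 'I_d * {ffun 'I_d -> 'I_Q}) :=
  [&& (0 < kc.1)%N, (2 * kc.1 <= d)%N & bad kc.1 kc.2].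
pose A (kc : 'I_d * {ffun 'I_d -> 'I_Q}) :=
  \bigcap_(i in [set: 'I_d]) (a i @^-1` [set z | (z %% Q)%Z = kc.2 i]).
pose b : R := Q%:R^-1 + (4 ^+ d)^-1.
have mA kc : measurable (A kc).
  by apply: fin_bigcap_measurable => // i _; exact: measurable_funPTI.
have A_le kc : J kc -> (P (A kc) <= (b ^+ d)%:E)%E.
  move=> _; apply: (independent_residues_prob (B := fun i => [set z | (z %% Q)%Z = kc.2 i])) => // i.
  exact: binomial_residue_prob.
have [mU U_le] := union_bound mA A_le.
apply: (@le_trans _ _ (P (\big[setU/set0]_(kc | J kc) A kc))).
  apply: le_measure; rewrite ?inE //.
    exact: (measurable_coefs_event a (fun f => ~ irreducible_over_Z f)).
  move=> w /= red; rewrite -bigcup_pred.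
  have Qz0 : Q%:Z != 0 by rewrite eqz_nat -lt0n.
  have res_lt i : (`|(a i w %% Q)%Z| < Q)%N.
    by rewrite -ltz_nat abszE ger0_norm ?modz_ge0 // ltz_pmod.
  pose c := [ffun i => Ordinal (res_lt i)].
  have cE i : (a i w %% Q)%Z = c i.
    by rewrite ffunE /= abszE ger0_norm // modz_ge0.
  have [k [k0 kd spl]] := reducible_splits d0 cE red.
  have lt_kd : (k < d)%N by move: d0 k0 kd; clear; lia.
  exists (Ordinal lt_kd, c) => /=; last by move=> i _ /=.
  rewrite /mkset unfold_in /J /= k0 kd /=; apply/allP => p ps_p; apply: spl; first exact: pr_ps.
  by rewrite /Q (big_rem p) //= dvdn_mulr.
apply: le_trans U_le _; rewrite lee_fin; apply: le_trans (total_mass R d_large).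
have -> : \sum_(kc | J kc) b ^+ d = \sum_(k < d) \sum_(c | J (k, c)) b ^+ d.
  by rewrite pair_big_dep /=; apply: eq_bigl => -[].
suff class_le (k : 'I_d) : \sum_(c | J (k, c)) b ^+ d <= 2 * (7 / 8) ^+ m.
  apply: le_trans (ler_sum _ (fun k _ => class_le k)) _.
  by rewrite sumr_const card_ord -[leLHS]mulr_natl.
rewrite sumr_const -[leLHS]mulr_natl.
have [/andP[k0 kd]|nJ] := boolP ((0 < k)%N && (2 * k <= d)%N); last first.
  rewrite eq_card0 ?mul0r ?mulr_ge0 ?exprn_ge0 ?divr_ge0 // => c.
  by rewrite unfold_in /= andbA (negbTE nJ).
apply: bad_class_mass => //; rewrite -[m]sz_ps.
have Hps' : {in ps, forall p, prime p && (2 * d <= p)%N}.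
  by move=> p /Hps/and3P[-> /ltnW].
apply: leq_trans (splits_mod_all_count k0 kd u_ps Hps').
rewrite leq_mul // /residue_count; apply/subset_leq_card/fintype.subsetP => c.
by rewrite unfold_in inE => /and3P[].
Qed.

End Bound.

Theorem theorem4p2 (R : realType)
    (disp : nat -> measure_display)
    (T : forall d : nat, measurableType (disp d))
    (P : forall d : nat, probability (T d) R)
    (a : forall d : nat, 'I_d -> {RV (P d) >-> int})
    (a_indep : forall d : nat, mutually_independent (a d))
    (a_binom : forall (d : nat) (i : 'I_d),
       centered_binomial (4 ^ (2 * d)) (a d i)) :
  P d [set w : T d | irreducible_over_Z (monic_of_coefs (fun i => a d i w))]
    @[d --> \oo] --> 1%E.
Proof.
have lower : (1 - (16 / d.+1%:R)%:E : \bar R)%E @[d --> \oo] --> (1 : \bar R)%E.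
  have lim1 : (fun d => 1 - 16 * harmonic d : R) @ \oo --> (1 : R).
    rewrite -[X in _ --> X](subr0 1) -[X in _ --> _ - X](mulr0 16).
    by apply: cvgB; [exact: cvg_cst|apply: cvgMr; exact: cvg_harmonic].
  by apply: cvg_EFin; [exact: nearW|exact: lim1].
apply: squeeze_cvge lower (cvg_cst 1%E).
near=> d; have d_large : (2 ^ 12 <= d)%N by near: d; exact: nbhs_infty_ge.
have mE := measurable_coefs_event (a d) irreducible_over_Z.
apply/andP; split; last exact: probability_le1.
have := reducible_prob_le d_large (a_indep d) (a_binom d).
rewrite -[X in P d X]/(~` _) probability_setC //.
by rewrite leeBlDr ?fin_num_measure // addeC leeBlDr.
Unshelve. all: by end_near.
Qed.
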